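(* For any integer $k\geq 3$, the class of all graphs of cliquewidth at most $k$ has Assouad--Nagata dimension $1$.
   Context: Graphs are finite and simple; $\mathrm{dist}_G$ is the shortest-path distance ($\infty$ between different components). The weak diameter of $S\subseteq V(G)$ in $G$ is $\max_{u,v\in S}\mathrm{dist}_G(u,v)$. For $r\in\mathbb{R}$, sets $S,T\subseteq V(G)$ are $r$-disjoint if $\mathrm{dist}_G(u,v)>r$ for all $u\in S,v\in T$; a collection is $r$-disjoint if its members are pairwise $r$-disjoint. A function $f:\mathbb{R}\to\mathbb{R}$ is a dilation if $f(r)=ar$ for some constant $a\in\mathbb{R}$. For an integer $n\geq 0$, $d:\mathbb{R}\to\mathbb{R}$ is an $n$-dimensional control function for a class $\mathcal{G}$ if for every $G\in\mathcal{G}$ and $r\in\mathbb{R}$ there are collections $\mathcal{C}_1,\dots,\mathcal{C}_{n+1}$ of subsets of $V(G)$ whose members together cover $V(G)$, each $\mathcal{C}_i$ is $r$-disjoint, and every member of every $\mathcal{C}_i$ has weak diameter in $G$ at most $d(r)$. The Assouad--Nagata dimension of $\mathcal{G}$ is the minimum $n$ such that some dilation is an $n$-dimensional control function for $\mathcal{G}$ ($\infty$ if none). Cliquewidth: with colourings $c:V(G)\to\{1,\dots,k\}$ (colour $i$ used if $c^{-1}(i)\ne\emptyset$), $(G,c)$ is a cliquewidth-$k$ pair if $|V(G)|\leq 1$ or: (OP1) $G$ is the disjoint union of nonempty $G_1,G_2$ with $(G_1,c|_{V(G_1)}),(G_2,c|_{V(G_2)})$ cliquewidth-$k$ pairs;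 or (OP2) there are a colouring $c'$ and distinct $i,j$, both used by $c'$, with $(G,c')$ a cliquewidth-$k$ pair and $c$ obtained from $c'$ by recolouring every vertex of colour $i$ to $j$; or (OP3) there are a proper spanning subgraph $G'$ of $G$ and distinct $i,j$ with $(G',c)$ a cliquewidth-$k$ pair and $G$ obtained from $G'$ by adding all edges between vertices coloured $i$ and vertices coloured $j$. The cliquewidth of $G$ is the least $k$ such that $(G,c)$ is a cliquewidth-$k$ pair for some colouring $c$ with colours $\{1,\dots,k\}$.
   Formalization: Control functions are required to work only for real r ≥ 0 rather than all real r: for negative r a dilation ar with a > 0 is negative while weak diameters are nonnegative, so under the literal definition only a = 0 could survive, complete graphs exclude it, and the dimension would be infinite. *)

(* Defs.v *)
From HB Require Import structures.
From mathcomp Require Import boolp classical_sets reals ereal.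
From mathcomp Require Import all_boot all_order all_algebra.

Set Implicit Arguments.
Unset Strict Implicit.
Unset Printing Implicit Defensive.

Import Order.TTheory GRing.Theory Num.Theory.

Record sgraph (V : finType) := SGraph {
  adj :> rel V;
  adj_sym : symmetric adj;
  adj_irr : irreflexive adj }.

Section Induced.
Variables (V : finType) (G : sgraph V) (A : {set V}).

Definition induced_adj : rel {x : V | x \in A} :=
  fun u v => G (val u) (val v).

Lemma induced_sym : symmetric induced_adj.
Proof. by move=> u v; apply: adj_sym. Qed.

Lemma induced_irr : irreflexive induced_adj.
Proof. by move=> u; apply: adj_irr. Qed.

Definition induced : sgraph {x : V | x \in A} :=
  SGraph induced_sym induced_irr.
End Induced.

Section CliqueWidth.
Variable k : nat.

Definition used (V : finType) (c : V -> 'I_k) (i : 'I_k) : Prop :=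
  exists v, c v = i.

(* The colours 1, ..., k are represented by 'I_k.  A decomposition of G as a
   disjoint union of nonempty graphs is given by a vertex set A, nonempty with
   nonempty complement, with no edge of G between A and ~: A: the two summands
   are then the induced subgraphs. *)
Inductive cw_pair :
    forall V : finType, sgraph V -> (V -> 'I_k) -> Prop :=
| CW_small (V : finType) (G : sgraph V) (c : V -> 'I_k) :
    #|V| <= 1 -> cw_pair G c
| CW_union (V : finType) (G : sgraph V) (c : V -> 'I_k) (A : {set V}) :
    A != set0 -> ~: A != set0 ->
    (forall u v, u \in A -> v \in ~: A -> ~~ G u v) ->
    cw_pair (induced G A) (fun u => c (val u)) ->
    cw_pair (induced G (~: A)) (fun u => c (val u)) ->
    cw_pair G c
| CW_recolour (V : finType) (G : sgraph V) (c c' : V -> 'I_k) (i j : 'I_k) :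
    i != j -> used c' i -> used c' j ->
    cw_pair G c' ->
    (forall v, c v = if c' v == i then j else c' v) ->
    cw_pair G c
| CW_join (V : finType) (G G' : sgraph V) (c : V -> 'I_k) (i j : 'I_k) :
    i != j ->
    (forall u v, G' u v -> G u v) -> (exists u v, G u v /\ ~~ G' u v) ->
    cw_pair G' c ->
    (forall u v, G u v = [|| G' u v, (c u == i) && (c v == j)
                                   | (c u == j) && (c v == i)]) ->
    cw_pair G c.

End CliqueWidth.

Definition has_cw_pair (V : finType) (G : sgraph V) (k : nat) : bool :=
  `[< exists c : V -> 'I_k, cw_pair G c >].

Section DelEdge.
Variables (V : finType) (G : sgraph V) (a b : V).

Definition del_adj : rel V := fun u v =>
  G u v && ~~ ((u == a) && (v == b) || (u == b) && (v == a)).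

Lemma del_sym : symmetric del_adj.
Proof.
move=> u v; rewrite /del_adj adj_sym orbC.
by rewrite [(u == b) && _]andbC [(u == a) && _]andbC.
Qed.

Lemma del_irr : irreflexive del_adj.
Proof. by move=> u; rewrite /del_adj adj_irr. Qed.

Definition del_edge : sgraph V := SGraph del_sym del_irr.
End DelEdge.

Lemma cw_pair_injective k (V : finType) (G : sgraph V) (c : V -> 'I_k) :
  injective c -> cw_pair G c.
Proof.
pose E (W : finType) (H : sgraph W) := [set p : W * W | H p.1 p.2].
have [m] := ubnP (#|V| + #|E V G|).
elim: m => // m IH in V G c *; rewrite ltnS => le_m c_inj.
case: (set_0Vmem (E V G)) => [E0|[[a b]]]; last first.
  rewrite inE /= => Gab.
  have nab : a != b by apply/eqP => ab; rewrite ab adj_irr in Gab.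
  apply: (@CW_join _ _ _ (del_edge G a b) _ (c a) (c b)).
  - by apply: contra nab => /eqP/c_inj->.
  - by move=> u v /andP[].
  - by exists a, b; split=> //=; rewrite /del_adj !eqxx andbF.
  - apply: IH => //; apply: leq_trans le_m; rewrite ltn_add2l.
    apply/proper_card/properP; split.
      by apply/subsetP=> p; rewrite !inE => /andP[].
    by exists (a, b); rewrite !inE //= /del_adj !eqxx andbF.
  - move=> u v; rewrite /= /del_adj !(inj_eq c_inj).
    have [/andP[/eqP-> /eqP->]|_] /= := boolP ((u == a) && (v == b)).
      by rewrite Gab orbT.
    have [/andP[/eqP-> /eqP->]|_] /= := boolP ((u == b) && (v == a)).
      by rewrite adj_sym Gab orbT.
    by rewrite andbT orbF.
have noE u v : G u v = false.
  by have := in_set0 (u, v); rewrite -E0 inE.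
have [V1|V2] := leqP #|V| 1; first exact: CW_small.
have [x _] : exists x : V, x \in V by apply/card_gt0P/ltnW.
have card_sub (A : {set V}) : #|A| < #|V| ->
    cw_pair (induced G A) (fun u => c (val u)).
  move=> ltA; apply: IH; last by move=> u v /c_inj/val_inj.
  rewrite (_ : E _ _ = set0); last first.
    by apply/setP=> p; rewrite !inE /= /induced_adj noE.
  rewrite cards0 addn0 card_sig; apply: leq_trans le_m.
  exact: leq_trans ltA (leq_addr _ _).
apply: (@CW_union _ _ _ _ [set x]).
- by rewrite -card_gt0 cards1.
- by rewrite -card_gt0 cardsC1 -subn1 subn_gt0.
- by move=> u v _ _; rewrite noE.
- by apply: card_sub; rewrite cards1.
- by apply: card_sub; rewrite cardsC1 ltn_predL ltnW.
Qed.

Lemma ex_has_cw_pair (V : finType) (G : sgraph V) : exists k, has_cw_pair G k.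
Proof.
exists #|V|; apply/asboolP; exists enum_rank.
exact/cw_pair_injective/enum_rank_inj.
Qed.

Definition cliquewidth (V : finType) (G : sgraph V) : nat :=
  ex_minn (ex_has_cw_pair G).

Definition graph_class := forall V : finType, sgraph V -> Prop.

Definition cw_at_most (k : nat) : graph_class :=
  fun V G => cliquewidth G <= k.

Section AssouadNagata.
Local Open Scope ring_scope.
Local Open Scope ereal_scope.
Variable R : realType.

(* The vertices of the path are u :: p, so that its length is size p; when
   there is no such path, the infimum is that of the empty set, namely +oo. *)
Definition dist (V : finType) (G : sgraph V) (u v : V) : \bar R :=
  ereal_inf [set (size p)%:R%:E | p in
    [set p : seq V | [/\ path G u p, uniq (u :: p) & last u p = v]]]%classic.

(* The weak diameter of the empty set is 0. *)
Definition weak_diam (V : finType) (G : sgraph V) (S : {set V}) : \bar R :=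
  \big[maxe/0]_(u in S) \big[maxe/0]_(v in S) dist G u v.

Definition r_disjoint (V : finType) (G : sgraph V) (r : R) (S T : {set V}) :=
  forall u v, u \in S -> v \in T -> r%:E < dist G u v.

Definition r_disjoint_collection (V : finType) (G : sgraph V) (r : R)
    (C : {set {set V}}) :=
  forall S T, S \in C -> T \in C -> S != T -> r_disjoint G r S T.

Definition dilation (f : R -> R) : Prop :=
  exists a : R, forall r, f r = (a * r)%R.

(* The scale r ranges over the nonnegative reals only: weak diameters are
   nonnegative, so over all real r the sole admissible dilation would be 0. *)
Definition control_function (n : nat) (d : R -> R) (F : graph_class) : Prop :=
  forall (V : finType) (G : sgraph V), F V G -> forall r : R, (0 <= r)%R ->
  exists C : 'I_n.+1 -> {set {set V}},
    [/\ \bigcup_(i < n.+1) cover (C i) = [set: V],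
        forall i, r_disjoint_collection G r (C i)
      & forall i S, S \in C i -> weak_diam G S <= (d r)%:E].

(* This infimum is a minimum, or +oo when the set is empty. *)
Definition AN_dim (F : graph_class) : \bar R :=
  ereal_inf [set n%:R%:E | n in
    [set n : nat | exists2 d, dilation d & control_function n d F]]%classic.

End AssouadNagata.

(* Main.v *)
Require Import Defs.
From mathcomp Require Import boolp classical_sets.
From mathcomp Require Import all_boot all_order all_algebra.
From mathcomp Require Import reals ereal.
From mathcomp Require Import zify ring.

Set Implicit Arguments.
Unset Strict Implicit.
Unset Printing Implicit Defensive.

(** Lower bound: paths have cliquewidth at most 3, and a 1-disjoint family that
    covers a path has a member containing the whole path.

    Upper bound: the construction of a graph of cliquewidth k is a binary tree
    of vertex sets A, each split into at most k classes of vertices with the same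
    neighbours outside A. Vertices of one class that has neighbours outside are at
    distance at most 2, so everything that leaves A passes close to one of k
    centres. For such a tree of sets with m centres per node, a 2-colouring whose
    monochromatic r-components have diameter O(r) is found by induction on m.
    Descend from a stage node with centres c. As long as a node has a centre near
    c, only m - 1 of its centres matter away from c; the first nodes without such
    a centre start new stages. The part between a stage node and the next ones,
    together with the points near the boundaries of the next ones (represented by
    at most m points each), is coloured by the induction hypothesis at a larger
    scale. Inside each new stage the boundary layer is followed by a layer of the
    first colour and then one of the second, so that no component leaving a stage
    goes deep into the next. *)

(** * Decompositions of a set with a distance *)

Lemma connect_closed_ind (T : finType) (e : rel T) (x : T) (P : T -> Prop) :
  P x -> (forall y z, connect e x y -> P y -> e y z -> P z) ->
  forall y, connect e x y -> P y.
Proof.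
move=> Px step y /connectP[p + ->]; elim/last_ind: p => [//|p z IH].
rewrite rcons_path last_rcons => /andP[ep ez]; apply: step ez; last exact: IH.
by apply/connectP; exists p.
Qed.

Inductive dec (V : finType) (q : nat) (P : {set V} -> Prop) : {set V} -> Prop :=
| dec_small (U : {set V}) : #|U| <= q -> dec q P U
| dec_node (A B : {set V}) : dec q P A -> dec q P B -> [disjoint A & B] -> P (A :|: B) ->
    dec q P (A :|: B).

Section Scales.
Variables (V : finType) (D : nat -> rel V).

(** [D n x y] stands for distance at most n in the ambient graph. It stays fixed while the induction
    passes to smaller sets, so all bounds are on weak diameters. *)
Record dist_scale : Prop := DistScale {
  scale_refl : forall n x, D n x x;
  scale_sym : forall n x y, D n x y -> D n y x;
  scale_trans : forall m n x y z, D m x y -> D n y z -> D (m + n) x z;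
  scale_le : forall m n x y, m <= n -> D m x y -> D n x y }.

Definition near n (c : seq V) x := has (D n x) c.

Definition sep N (X U : {set V}) bd := forall n x y, 0 < n <= N ->
  x \in U -> y \in X :\: U -> D n x y -> near (2 * n) bd x.

Definition sepdec N X m q :=
  dec q (fun U => exists2 bd, size bd <= m & sep N X U bd).

Definition mono r (Z : {set V}) (chi : V -> bool) : rel V :=
  [rel x y | [&& x \in Z, y \in Z, chi x == chi y & D r x y]].

Definition bounded r L Z chi := forall x y, connect (mono r Z chi) x y -> D L x y.

Hypothesis DS : dist_scale.

Lemma near_trans m n l c x y : m + n <= l -> D m x y -> near n c y -> near l c x.
Proof.
move=> le Dxy /hasP[b bc Dyb]; apply/hasP; exists b => //.
by apply: scale_le le _ => //; apply: scale_trans Dyb.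
Qed.

Lemma near_le m n c x : m <= n -> near m c x -> near n c x.
Proof. by move=> le; apply: near_trans (scale_refl DS 0 x). Qed.

Lemma mono_sym r Z chi : symmetric (mono r Z chi).
Proof.
move=> x y; rewrite /mono /= eq_sym.
have -> : D r x y = D r y x by apply/idP/idP; apply: scale_sym.
by rewrite andbCA.
Qed.

Lemma eq_mono r (Z : {set V}) chi chi' :
  {in Z, chi =1 chi'} -> mono r Z chi =2 mono r Z chi'.
Proof.
move=> E x y; rewrite /mono /=; case: (boolP (x \in Z)) => //= xZ.
by case: (boolP (y \in Z)) => //= yZ; rewrite !E.
Qed.

Lemma connect_small (e : rel V) r (W : {set V}) x y :
  (forall u v, e u v -> D r u v) -> (forall z, connect e x z -> z \in W) ->
  connect e x y -> D (#|W| * r) x y.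
Proof.
move=> eD eW /connectP[p0 ep0 ->]; case: (shortenP ep0) => p ep up _.
have le_p : size p <= #|W|.
  have : size (x :: p) <= #|W|.
    rewrite cardE; apply: uniq_leq_size => // z zp; rewrite mem_enum.
    by apply: eW; case/splitPl: zp ep => p1 p2 <-; rewrite cat_path => /andP[ep1 _];
       apply/connectP; exists p1.
  exact: ltnW.
apply: (@scale_le DS (size p * r)); first by rewrite leq_mul2r le_p orbT.
elim: p x ep {up le_p eW ep0} => [|z p IH] x /=; first by rewrite scale_refl.
by move=> /andP[/eD xz zp]; rewrite mulSn; apply: scale_trans xz (IH _ zp).
Qed.

(** Send each point to the first centre of [c] near it: consecutive images are within 2 * n + r, and
    a simple path on the images has at most [size c] steps. *)
Lemma connect_near (e : rel V) r n c x y :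
  (forall u v, e u v -> D r u v) -> (forall z, connect e x z -> near n c z) ->
  connect e x y -> D (size c * (2 * n + r) + 2 * n) x y.
Proof.
move=> eD ec exy.
pose g z := nth x c (find (D n z) c).
have gP z : near n c z -> g z \in c /\ D n z (g z).
  by move=> nz; split; [rewrite mem_nth // -has_find | apply: nth_find].
pose e2 := [rel u v | [&& u \in c, v \in c & D (2 * n + r) u v]].
have [gx Dx] := gP _ (ec _ (connect0 _ _)).
have [gy Dy] := gP _ (ec _ exy).
have e2g : connect e2 (g x) (g y).
  elim/connect_closed_ind: y / exy {gy Dy} => [|y z xy IH yz]; first exact: connect0.
  apply: connect_trans IH (connect1 _).
  have [gy Dy] := gP _ (ec _ xy).
  have [gz Dz] := gP _ (ec _ (connect_trans xy (connect1 yz))).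
  rewrite /= gy gz /=.
  have := scale_trans DS (scale_sym DS Dy) (scale_trans DS (eD _ _ yz) Dz).
  by apply: scale_le => //; lia.
have e2D u v : e2 u v -> D (2 * n + r) u v by case/and3P.
have e2c z : connect e2 (g x) z -> z \in [set z in c].
  by move=> xz; elim/connect_closed_ind: z / xz => [|z t _ _ /and3P[]]; rewrite inE.
have := connect_small e2D e2c e2g.
move=> Dg; apply: scale_le (scale_trans DS Dx (scale_trans DS Dg (scale_sym DS Dy))) => //.
have : #|[set z in c]| <= size c by rewrite cardsE card_size.
by nia.
Qed.

(** * Decompositions without centres *)

Section Base.
Variables (r q : nat) (X : {set V}).
Hypothesis r_gt0 : 0 < r.

(** Without centres no step of length [r] leaves a node. A component thus either lies in a child
    treated by induction, or meets each of two children in at most q points. *)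
Lemma sepdec0_bounded : sepdec r X 0 q X ->
  bounded r (2 * q * r) X (fun=> true).
Proof.
move=> decX; set e := mono r X (fun=> true).
pose C x := [set y | connect e x y].
have eC : connect_sym e by apply: sym_connect_sym; apply: mono_sym.
have CE x y : y \in C x -> C x = C y.
  by rewrite inE => xy; apply/setP=> z; rewrite !inE (same_connect eC xy).
have small U : sepdec r X 0 q U -> U \subset X ->
    #|U| <= q \/ {in U, forall x, C x \subset U /\ #|C x| <= 2 * q}.
  elim=> {U} [U|A B _ IHA _ IHB dAB [bd]]; first by left.
  rewrite leqn0 => /nilP-> sepU; rewrite subUset => /andP[/IHA{}IHA /IHB{}IHB].
  right=> x xU; have CU : C x \subset A :|: B.
    apply/subsetP=> y; rewrite inE => xy.
    elim/connect_closed_ind: y / xy => // y z _ yU /and4P[_ zX _ Dyz].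
    apply: contraT => zU; have := sepU r y z; rewrite r_gt0 leqnn => /(_ isT yU).
    by rewrite inE zU zX => /(_ isT Dyz).
  split=> //.
  have part (A' : {set V}) :
      #|A'| <= q \/ {in A', forall x, C x \subset A' /\ #|C x| <= 2 * q} ->
      #|C x| <= 2 * q \/ #|C x :&: A'| <= q.
    case=> [le_q|IH].
      by right; apply: leq_trans le_q; apply: subset_leq_card (subsetIr _ _).
    case: (set_0Vmem (C x :&: A')) => [->|[y]]; first by rewrite cards0; right.
    by rewrite inE => /andP[/CE-> /IH[_]]; left.
  case: (part _ IHA) => // cA; case: (part _ IHB) => // cB.
  rewrite -(setIidPl CU) setIUr mul2n -addnn.
  by apply: leq_trans (leq_add cA cB); rewrite cardsU leq_subr.
move=> x y xy; have [xX|xX] := boolP (x \in X); last first.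
  case/connectP: xy => [[|z p]] /=; first by move=> _ ->; apply: scale_refl.
  by case/andP=> /and4P[]; rewrite (negPf xX).
have CX : forall z, connect e x z -> z \in X.
  by move=> z xz; elim/connect_closed_ind: z / xz => // z t _ _ /and4P[].
have cC : #|C x| <= 2 * q.
  case: (small _ decX (subxx _)) => [le_q|/(_ x xX)[]//].
  apply: leq_trans (subset_leq_card _) (leq_trans le_q _); last by lia.
  by apply/subsetP=> z; rewrite inE; apply: CX.
apply: (@scale_le DS (#|C x| * r)); first by rewrite leq_mul2r cC orbT.
apply: connect_small xy => [u v /and4P[]//|z].
by rewrite inE.
Qed.
End Base.
End Scales.

(** * The induction on the number of centres *)

Section Step.
Variables (V : finType) (D : nat -> rel V) (DS : dist_scale D).
Variables (r N N' m q L L' Q M : nat) (X : {set V}).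
Hypotheses (r_gt0 : 0 < r) (le_rN : r <= N) (le_NN : N' <= N) (le_mq : m < q).
(* M bounds the displacement along a path inside the layers of a node; beyond
   distance Q from c, no step of length at most N' goes past a centre that is
   within 6 * r of c. *)
Hypothesis M_def : M = m.+1 * (7 * r) + 6 * r.
Hypothesis Q_def : Q = 6 * r + 2 * N'.
Hypothesis L_ge1 : 2 * (2 * M + L' + 8 * r) <= L.
Hypothesis L_ge2 : m.+1 * (2 * (Q + (2 * M + L' + 12 * r)) + r)
                   + 2 * (Q + (2 * M + L' + 12 * r)) <= L.
Hypothesis colouring : forall Y : {set V}, sepdec D N' Y m q Y ->
  exists chi, bounded D (M + 8 * r) L' Y chi.

Definition lay0 (U : {set V}) := [set x in U | [exists y in X :\: U, D r x y]].
Definition lay1 (U : {set V}) := [set x in U :\: lay0 U | [exists y in lay0 U, D r x y]].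

(* lay0 U is left out of the bound: its colours are chosen by the enclosing
   stage, and the colours next to it stop the components that enter from there. *)
Definition insulated (U : {set V}) (chi : V -> bool) :=
  [/\ {in lay1 U, forall x, chi x},
      forall x y, x \in U :\: lay0 U -> x \notin lay1 U -> y \in lay1 U ->
        D r x y -> ~~ chi x
    & bounded D r L (U :\: lay0 U) chi].

(* For a stage with centres c that contains the node U: W is the part of U that
   belongs to this stage, S x is the node containing x at which a new stage
   starts, nb x its centres and chi its colouring. The last clause is the
   decomposition with one centre fewer, restricted to points far from c. *)
Definition staged (U : {set V}) (c : seq V) :=
  exists (W : {set V}) (S : V -> {set V}) (nb : V -> seq V) (chi : V -> bool),
  [/\ W \subset U,
      forall x, x \in U :\: W ->
        [/\ x \in S x, S x \subset U :\: W, {in S x, forall y, S y = S x /\ nb y = nb x},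
            size (nb x) <= m.+1
          & [/\ sep D N X (S x) (nb x), ~~ has (near D (6 * r) c) (nb x)
              & insulated (S x) chi]]
    & forall Y : {set V}, Y \subset X -> {in Y, forall x, ~~ near D Q c x} ->
        {in U :\: W, forall x, #|Y :&: S x| <= q} -> sepdec D N' Y m q (Y :&: U)].

Lemma eq_insulated (U : {set V}) chi chi' :
  {in U, chi =1 chi'} -> insulated U chi -> insulated U chi'.
Proof.
move=> E [h1 h2 h3].
have E' : {in U :\: lay0 U, chi =1 chi'} by move=> x /setDP[xU _]; apply: E.
split.
- by move=> x xl; rewrite -E' ?h1 //; move: xl; rewrite inE => /andP[].
- by move=> x y xU xl yl Dxy; rewrite -E' //; apply: h2 yl Dxy.
- by move=> x y; rewrite -(eq_connect (eq_mono D r E')); apply: h3.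
Qed.

Lemma staged_small (U : {set V}) c : #|U| <= q -> staged U c.
Proof.
move=> le_q; exists U, (fun=> set0), (fun=> [::]), (fun=> true); split=> //.
  by move=> x; rewrite setDv inE.
move=> Y _ _ _; apply: dec_small; apply: leq_trans le_q.
exact/subset_leq_card/subsetIr.
Qed.

(** All of [U] is one new stage, so [W] is empty and [Y :&: U] is small enough to be a leaf. *)
Lemma staged_next (U : {set V}) bd c chi :
  size bd <= m.+1 -> sep D N X U bd -> ~~ has (near D (6 * r) c) bd ->
  insulated U chi -> staged U c.
Proof.
move=> le_bd sepU far ins; exists set0, (fun=> U), (fun=> bd), chi.
split; first exact: sub0set.
  by move=> x; rewrite setD0 => xU.
move=> Y _ _ small; apply: dec_small.
case: (set_0Vmem U) => [->|[x xU]]; first by rewrite setI0 cards0.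
by apply: small; rewrite setD0; apply: xU.
Qed.

Lemma staged_node (A B : {set V}) bd c :
  staged A c -> staged B c -> [disjoint A & B] -> sep D N X (A :|: B) bd ->
  size [seq b <- bd | ~~ near D (6 * r) c b] <= m -> staged (A :|: B) c.
Proof.
move=> [WA [SA [nA [cA [WsA hA dA]]]]] [WB [SB [nB [cB [WsB hB dB]]]]] dAB sepU szbd.
have nAB x : x \in B -> x \in A = false by move=> xB; apply: (disjointFl dAB).
pose pickA T (f g : V -> T) x := if x \in A then f x else g x.
exists (WA :|: WB), (pickA _ SA SB), (pickA _ nA nB), (pickA _ cA cB).
have inA x : x \in A -> x \in (A :|: B) :\: (WA :|: WB) -> x \in A :\: WA.
  by move=> xA; rewrite !inE xA negb_or => /andP[/andP[-> _]].
have inB x : x \notin A -> x \in (A :|: B) :\: (WA :|: WB) -> x \in B :\: WB.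
  by move=> xA; rewrite !inE (negPf xA) negb_or => /andP[/andP[_ ->]].
have subA : A :\: WA \subset (A :|: B) :\: (WA :|: WB).
  apply/subsetP=> x; rewrite !inE negb_or => /andP[-> xA]; rewrite xA /= andbT.
  by apply: contraL xA => /(subsetP WsB)/nAB->.
have subB : B :\: WB \subset (A :|: B) :\: (WA :|: WB).
  apply/subsetP=> x; rewrite !inE negb_or => /andP[-> xB]; rewrite xB orbT !andbT.
  by apply: contraTN xB => /(subsetP WsA) xA; rewrite (disjointFr dAB xA).
split; first exact: setUSS.
  move=> x xU; rewrite /pickA; case: ifPn => xA.
    have [xS SsA eqS szn [sepS farS ins]] := hA _ (inA _ xA xU).
    have sA y : y \in SA x -> y \in A by move=> /(subsetP SsA)/setDP[].
    split=> //; first exact: subset_trans SsA subA.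
      by move=> y yS; rewrite (sA _ yS); apply: eqS.
    by split=> //; apply: eq_insulated ins => y yS; rewrite /pickA sA.
  have [xS SsB eqS szn [sepS farS ins]] := hB _ (inB _ xA xU).
  have sB y : y \in SB x -> y \in A = false.
    by move=> /(subsetP SsB)/setDP[yB _]; apply: nAB.
  split=> //; first exact: subset_trans SsB subB.
    by move=> y yS; rewrite (sB _ yS); apply: eqS.
  by split=> //; apply: eq_insulated ins => y yS; rewrite /pickA sB.
move=> Y YX farY smallY.
have decA : sepdec D N' Y m q (Y :&: A).
  apply: dA => // x xA; have := smallY x (subsetP subA _ xA).
  by rewrite /pickA; case/setDP: xA => ->.
have decB : sepdec D N' Y m q (Y :&: B).
  apply: dB => // x xB; have := smallY x (subsetP subB _ xB).
  by rewrite /pickA; case/setDP: xB => /nAB->.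
rewrite setIUr; apply: dec_node => //.
  rewrite -setI_eq0 setIACA setIid; move: dAB; rewrite -setI_eq0 => /eqP->.
  by rewrite setI0.
exists [seq b <- bd | ~~ near D (6 * r) c b] => //.
move=> n x y /andP[n0 nN]; rewrite -setIUr => /setIP[xY xU].
rewrite !inE => /andP[+ yY]; rewrite yY /= => yU Dxy.
have := sepU n x y; rewrite n0 (leq_trans nN le_NN) !inE yU (subsetP YX _ yY).
move: xU; rewrite inE => xU /(_ isT xU isT Dxy)/hasP[].
move=> b bbd Dxb; apply/hasP; exists b => //; rewrite mem_filter bbd andbT.
apply: contra (farY _ xY) => nb; apply: (near_trans DS _ Dxb nb).
by rewrite Q_def; move: nN; clear; lia.
Qed.

(** * The colouring of one stage *)

Section Glue.
Variables (U W : {set V}) (c : seq V) (S : V -> {set V}) (nb : V -> seq V).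
Variables (chi0 chi1 : V -> bool).
Hypotheses (UX : U \subset X) (sz_c : size c <= m.+1) (WU : W \subset U).
Hypothesis lay0_c : {in lay0 U, forall x, near D (2 * r) c x}.
Hypothesis S_P : forall x, x \in U :\: W ->
  [/\ x \in S x, S x \subset U :\: W, {in S x, forall y, S y = S x /\ nb y = nb x},
      size (nb x) <= m.+1
    & [/\ sep D N X (S x) (nb x), ~~ has (near D (6 * r) c) (nb x)
        & insulated (S x) chi0]].

Definition core := [set x in U :\: lay0 U | (x \in W) || (x \in lay0 (S x))].
(** The boundary layer of a new stage may be large; replacing its points by one chosen point per
    centre keeps the set coloured recursively small in each piece. *)
Definition repr_at (A : {set V}) b := [pick z in A | D (2 * r) z b].
Definition repr x :=
  odflt x (repr_at (S x) (nth x (nb x) (find (D (2 * r) x) (nb x)))).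
Definition foot x := if x \in W then x else repr x.
Definition feet := [set z in foot @: core | ~~ near D Q c z].
(** [lay1 U] is tested first because it is itself within [Q] of [c]. The constant colour near [c]
    insulates [lay1 U], and components meeting that zone stay near the few centres in [c]. *)
Definition glued x :=
  if x \in W then (if x \in lay1 U then true
                   else if near D Q c x then false else chi1 x)
  else if x \in lay0 (S x) then (if near D Q c (repr x) then false
                                 else chi1 (repr x))
  else chi0 x.
Hypothesis chi1_P : bounded D (M + 8 * r) L' feet chi1.

Lemma lay0P (A : {set V}) x :
  reflect (x \in A /\ exists2 y, y \in X :\: A & D r x y) (x \in lay0 A).
Proof.
rewrite inE; apply: (iffP andP) => [[xA /existsP[y /andP[]]]|[xA [y yA Dxy]]].
  by split=> //; exists y.
by split=> //; apply/existsP; exists y; rewrite yA.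
Qed.

Lemma lay1P (A : {set V}) x :
  reflect [/\ x \in A, x \notin lay0 A & exists2 y, y \in lay0 A & D r x y]
          (x \in lay1 A).
Proof.
rewrite [x \in lay1 A]inE in_setD.
apply: (iffP andP) => [[/andP[xA xl] /existsP[y /andP[]]]|[xA xl [y yA Dxy]]].
  by split=> //; exists y.
by rewrite xA xl; split=> //; apply/existsP; exists y; rewrite yA.
Qed.

Lemma S_near x : x \in U :\: W -> x \in lay0 (S x) -> near D (2 * r) (nb x) x.
Proof.
move=> /S_P[_ _ _ _ [sepS _ _]] /lay0P[xS [y yS Dxy]].
by apply: (sepS r x y) => //; rewrite r_gt0.
Qed.

Lemma S_far n x : x \in U :\: W -> x \in lay0 (S x) -> n <= 4 * r ->
  ~~ near D n c x.
Proof.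
move=> xUW xl le_n; have [_ _ _ _ [_ far _]] := S_P xUW.
apply: contra far => nx; have /hasP[b bn Dxb] := S_near xUW xl.
apply/hasP; exists b => //; apply: (near_trans DS _ (scale_sym DS Dxb) nx) => //.
by move: le_n; clear; lia.
Qed.

(* A point of a staged piece S x that is close to the boundary of U would bring
   the centres of S x close to those of U. *)
Lemma near_W n x : x \in U -> n <= 3 * r -> 
  (x \in lay0 U \/ exists y, [/\ D r x y, y \in W & near D n c y]) -> x \in W.
Proof.
move=> xU le_n H; apply: contraT => xW.
have xUW : x \in U :\: W by rewrite inE xW.
have [xS SU eqS _ _] := S_P xUW.
have l0 : x \in lay0 (S x).
  apply/lay0P; split=> //; case: H => [/lay0P[_ [y yU Dxy]]|[y [Dxy yW _]]].
    exists y => //; move: yU; rewrite !inE => /andP[yU ->]; rewrite andbT.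
    by apply: contra yU => /(subsetP SU)/setDP[].
  exists y => //; rewrite inE (subsetP UX) ?(subsetP WU) // andbT.
  by apply: contraL yW => /(subsetP SU)/setDP[].
case: H => [/lay0_c xc|[y [Dxy _ yc]]].
  have /negP[] := @S_far (2 * r) x xUW l0 (ltac:(clear; lia)); exact: xc.
have /negP[] := @S_far (4 * r) x xUW l0 (leqnn _).
by apply: (near_trans DS _ Dxy yc) => //; move: le_n; clear; lia.
Qed.

Lemma lay0_W x : x \in lay0 U -> x \in W.
Proof.
move=> xl; apply: (@near_W 0) => //; last by left.
by case/lay0P: xl.
Qed.

Lemma lay1_near x : x \in lay1 U -> near D (3 * r) c x.
Proof.
case/lay1P=> _ _ [y /lay0_c yc Dxy].
by apply: (near_trans DS _ Dxy yc); clear; lia.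
Qed.

Lemma lay1_W x : x \in lay1 U -> x \in W.
Proof.
case/lay1P=> xU _ [y yl Dxy]; apply: (@near_W (2 * r)) => //.
  by clear; lia.
by right; exists y; split=> //; [apply: lay0_W | apply: lay0_c].
Qed.

Lemma repr_P x : x \in U :\: W -> x \in lay0 (S x) ->
  [/\ repr x \in S x, D (4 * r) x (repr x)
    & exists2 b, b \in nb x & repr_at (S x) b = Some (repr x)].
Proof.
move=> xUW xl; have nx := S_near xUW xl.
have [xS _ _ _ _] := S_P xUW.
rewrite /repr; set b := nth _ _ _.
have Dxb : D (2 * r) x b by apply: nth_find.
have bn : b \in nb x by rewrite mem_nth // -has_find.
case E: (repr_at _ _) => [z|] /=; last first.
  by move: E; rewrite /repr_at; case: pickP => // /(_ x); rewrite xS Dxb.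
split; [| |by exists b]; move: E; rewrite /repr_at; case: pickP => [z' /andP[zS Dzb] [<-]|] //.
have := scale_trans DS Dxb (scale_sym DS Dzb).
by apply: (scale_le DS); clear; lia.
Qed.

Lemma coreP x : reflect [/\ x \in U, x \notin lay0 U
   & x \in W \/ x \in U :\: W /\ x \in lay0 (S x)] (x \in core).
Proof.
rewrite [x \in core]inE [x \in U :\: lay0 U]in_setD.
apply: (iffP andP) => [[/andP[-> xU]]|[xU -> h]].
  move=> h; split=> //; case: (boolP (x \in W)) h => [|xW /= xl]; first by left.
  by right; rewrite inE xW xU.
by rewrite xU; split=> //; case: h => [->//|[_ ->]]; rewrite orbT.
Qed.

Lemma foot_D x : x \in core -> D (4 * r) x (foot x).
Proof.
case/coreP=> _ _ [xW|[xUW xl]]; rewrite /foot.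
  by rewrite xW scale_refl.
by case/setDP: (xUW) => _ /negPf->; case: (repr_P xUW xl).
Qed.

Lemma foot_U x : x \in core -> foot x \in U.
Proof.
case/coreP=> xU _ [xW|[xUW xl]]; rewrite /foot; first by rewrite xW.
case/setDP: (xUW) => _ /negPf->; case: (repr_P xUW xl) => + _ _.
by have [_ SU _ _ _] := S_P xUW => /(subsetP SU)/setDP[].
Qed.

Lemma feet_U : feet \subset U.
Proof.
by apply/subsetP=> _ /[1!inE] /andP[/imsetP[x /foot_U xU ->]].
Qed.

(** A foot in [S x] lies outside [W], so it represents one of the centres [nb x], of which there are
    at most m.+1 <= q. *)
Lemma card_feet x : x \in U :\: W -> #|feet :&: S x| <= q.
Proof.
move=> xUW; have [_ SU eqS szn _] := S_P xUW.
apply: leq_trans (leq_trans szn le_mq).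
rewrite cardE -(size_map (repr_at (S x)) (nb x)) -(size_map Some (enum _)).
apply: uniq_leq_size => [|o].
  by rewrite map_inj_uniq ?enum_uniq // => u v [].
case/mapP=> z; rewrite mem_enum => /setIP[/[1!inE] /andP[/imsetP[y yc ->] _]] yS ->.
have nW : foot y \notin W by case/setDP: (subsetP SU _ yS).
move: yS; case/coreP: yc nW => yU _; rewrite /foot; case: ifPn => [yW _ /negP//|yW].
case=> [/idPn//|[yUW yl] _]; have [rS _ [b bn <-]] := repr_P yUW yl.
move=> rSx; have [_ _ eqSy _ _] := S_P yUW.
have [<- <-] := eqS _ rSx; have [-> ->] := eqSy _ rS.
by apply/mapP; exists b.
Qed.

Lemma glued_foot x : x \in core -> ~~ near D Q c (foot x) ->
  glued x = chi1 (foot x).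
Proof.
case/coreP=> xU _ [xW|[xUW xl]]; rewrite /foot /glued.
  rewrite xW => /[dup] nx /negPf->; case: ifP => // /lay1_near.
  move=> n3; case/negP: nx; apply: (near_le DS _ n3).
  by rewrite Q_def; clear; lia.
by case/setDP: (xUW) => _ /negPf-> /negPf; rewrite xl => ->.
Qed.

Lemma glued_lay1 x : x \in lay1 U -> glued x.
Proof. by move=> xl; rewrite /glued (lay1_W xl) xl. Qed.

(** Such an [x] is in [W] by [near_W], and within 4 * r < Q of [c], hence in the zone coloured
    false. *)
Lemma glued_next x y : x \in U :\: lay0 U -> x \notin lay1 U -> y \in lay1 U ->
  D r x y -> ~~ glued x.
Proof.
case/setDP=> xU _ /negPf xl yl Dxy; have ny := lay1_near yl.
have xW : x \in W.
  apply: (@near_W (3 * r)) => //; right; exists y; split=> //; exact: lay1_W.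
rewrite /glued xW xl (_ : near _ _ _ _) //.
by apply: (near_trans DS _ Dxy ny) => //; rewrite Q_def; clear; lia.
Qed.

Let Z := U :\: lay0 U.
Let e := mono D r Z glued.
Let shell x := x \in U :\: W /\ x \in lay1 (S x).

Lemma edge_Z x y : e x y -> [/\ x \in Z, y \in Z, glued x = glued y & D r x y].
Proof. by case/and4P=> ? ? /eqP. Qed.

Lemma notin_core x : x \in Z -> x \notin core -> x \in U :\: W /\ x \notin lay0 (S x).
Proof.
case/setDP=> xU xl; rewrite inE !in_setD xU xl /= negb_or.
by case/andP=> -> ->.
Qed.

Lemma edge_S x y : x \in U :\: W -> x \notin lay0 (S x) -> e x y -> y \in S x.
Proof.
move=> xUW xl /edge_Z[_ /setDP[yU _] _ Dxy]; apply: contraR xl => yS.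
have [xS _ _ _ _] := S_P xUW; apply/lay0P; split=> //.
by exists y => //; rewrite inE yS (subsetP UX).
Qed.

Lemma S_UW x y : x \in U :\: W -> y \in S x ->
  [/\ y \in U :\: W, S y = S x & nb y = nb x].
Proof.
move=> xUW yS; have [_ /subsetP/(_ y yS) yUW /(_ y yS)[? ?] _ _] := S_P xUW.
by split.
Qed.

Lemma edge_out x y : e x y -> x \in core -> y \notin core ->
  [/\ shell y, x \in S y & x \in lay0 (S y)].
Proof.
move=> exy xc yc; have [xZ yZ _ Dxy] := edge_Z exy.
have [yUW yl] := notin_core yZ yc.
have xS : x \in S y by apply: edge_S => //; rewrite /e mono_sym.
have [xUW eqS _] := S_UW yUW xS.
have xl : x \in lay0 (S y).
  by case/coreP: xc => _ _ [xW|[_]]; [case/setDP: xUW; rewrite xW | rewrite eqS].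
have [yS _ _ _ _] := S_P yUW.
split=> //; split=> //; apply/lay1P; split=> //.
by exists x => //; apply: (scale_sym DS).
Qed.

Lemma glued_S x : x \in U :\: W -> x \notin lay0 (S x) -> glued x = chi0 x.
Proof. by rewrite /glued => /setDP[_ /negPf->] /negPf->. Qed.

Lemma shell_notin x : shell x -> x \notin lay0 (S x).
Proof. by case=> _ /lay1P[]. Qed.

(** [lay1 (S x)] is coloured true and what touches it further inside is false, so a component
    entering a new stage stays in the shell until it returns to the core. *)
Lemma edge_shell x y : e x y -> shell x -> y \notin core -> shell y.
Proof.
move=> exy rx yc; have [xZ yZ eq_g Dxy] := edge_Z exy.
have xl := shell_notin rx; case: rx => xUW xl1.
have [yUW yl] := notin_core yZ yc.
have yS := edge_S xUW xl exy.
have [_ eqS _] := S_UW xUW yS.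
split=> //; rewrite eqS; apply: contraT => yl1; rewrite eqS in yl.
have [_ _ _ _ [_ _ [white black _]]] := S_P xUW.
have := black y x _ yl1 xl1 (scale_sym DS Dxy); rewrite inE yS yl.
by rewrite -glued_S ?eqS // -eq_g glued_S // white // => /(_ isT).
Qed.

Lemma S_near3 x y : x \in U :\: W -> y \in S x -> y \in lay0 (S x) ->
  near D (3 * r) (nb x) y.
Proof.
move=> xUW yS yl; have [yUW eqS eqn] := S_UW xUW yS.
rewrite -eqS in yl; rewrite -eqn; apply: (near_le DS _ (S_near yUW yl)).
by clear; lia.
Qed.

Lemma shell_near x : shell x -> near D (3 * r) (nb x) x.
Proof.
case=> xUW /lay1P[_ _ [y yl Dxy]].
have yS : y \in S x by case/lay0P: yl.
have [yUW eqS eqn] := S_UW xUW yS.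
rewrite -eqn; apply: (near_trans DS _ Dxy (S_near yUW _)); last by rewrite eqS.
by clear; lia.
Qed.

Let run (s : seq V) := [rel x y | [&& near D (3 * r) s x, near D (3 * r) s y & D r x y]].

(** [M] is the bound of [connect_near] for n = 3 * r and m.+1 centres. *)
Lemma run_D x z y : x \in U :\: W -> near D (3 * r) (nb x) z ->
  connect (run (nb x)) z y -> D M z y.
Proof.
move=> xUW nz zy; have [_ _ _ szn _] := S_P xUW.
have runD u v : run (nb x) u v -> D r u v by case/and3P.
have runN t : connect (run (nb x)) z t -> near D (3 * r) (nb x) t.
  by move=> zt; elim/connect_closed_ind: t / zt => // t t' _ _ /and3P[].
apply: (scale_le DS _ (connect_near DS runD runN zy)).
rewrite M_def; move: szn; clear; nia.
Qed.

Let far_core x := x \in core /\ ~~ near D Q c (foot x).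
Let e1 := mono D (M + 8 * r) feet chi1.

(* [linked w u z]: a path from u to z whose core vertices after u are all far
   from c and have the colour of w projects to a path of the coloured feet. *)
Let linked w u z := z = u \/
  [/\ far_core z, glued z = glued w
    & exists u', [/\ u' \in core, D M u u' & connect e1 (foot u') (foot z)]].

(** The second case is an excursion: the path entered a shell from the core vertex [z] and has
    stayed near the centres of that stage since. *)
Let reached w u y := (y \in core /\ linked w u y) \/
  (shell y /\ exists z, [/\ z \in core, linked w u z, near D (3 * r) (nb y) z
                        & connect (run (nb y)) z y]).

(** An excursion moves by at most [M] and a foot is within 4 * r of its core vertex, whence the
    scale M + 8 * r at which the feet are coloured. *)
Lemma linked_step w u z y : z \in core -> linked w u z -> far_core y ->
  glued y = glued w -> D M z y -> linked w u y.
Proof.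
move=> zc uz fy gy Dzy; have [yc yn] := fy; right; split=> //.
case: uz => [eq_zu|[[_ zn] gz [u' [u'c Du zu']]]].
  by exists y; split; rewrite -?eq_zu //; apply: connect0.
exists u'; split=> //; apply: connect_trans zu' (connect1 _).
apply/and4P; split.
- by rewrite inE zn andbT imset_f.
- by rewrite inE yn andbT imset_f.
- by rewrite -!glued_foot // gz gy.
have := scale_trans DS (scale_sym DS (foot_D zc)) (scale_trans DS Dzy (foot_D yc)).
by apply: (scale_le DS); clear; lia.
Qed.

(** [u] is the last core vertex of the path whose foot is near [c], or [w] if there is none. After
    [u] core vertices have the [chi1] colours of their feet. *)
Lemma reach w y : w \in core -> connect e w y -> exists u,
  [/\ u \in core, connect e w u, u = w \/ near D Q c (foot u), reached w u y
    & glued y = glued w].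
Proof.
have rM : r <= M by rewrite M_def; clear; nia.
move=> wc wy; elim/connect_closed_ind: y / wy => [|y z wy [u [uc wu uw uy gy]] eyz].
  by exists w; split; [|exact: connect0|left|left; split=> //; left|].
have [yZ zZ gyz Dyz] := edge_Z eyz.
have gz : glued z = glued w by rewrite -gyz.
have [zc|zc] := boolP (z \in core).
  case: (boolP (near D Q c (foot z))) => [zn|zn].
    have wz : connect e w z := connect_trans wy (connect1 eyz).
    by exists z; split; [| |right|left; split=> //; left|].
  exists u; split=> //; left; split=> //.
  case: uy => [[yc lk]|[ry [t [tc lk nt ty]]]].
    by apply: linked_step lk _ _ _ => //; apply: (scale_le DS rM).
  have yl := shell_notin ry; have [yUW _] := ry.
  have zS := edge_S yUW yl eyz.
  have [zUW eqS eqn] := S_UW yUW zS.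
  have zl : z \in lay0 (S y).
    by case/coreP: zc => _ _ [zW|[_]]; [case/setDP: zUW; rewrite zW | rewrite eqS].
  apply: linked_step lk _ _ _ => //; apply: (run_D yUW nt _).
  apply: connect_trans ty (connect1 _).
  by apply/and3P; split; [exact: shell_near | exact: (S_near3 yUW zS zl) |].
exists u; split=> //; right.
case: uy => [[yc lk]|[ry [t [tc lk nt ty]]]].
  have [rz yS yl] := edge_out eyz yc zc; have [zUW _] := rz.
  have ny := S_near3 zUW yS yl.
  split=> //; exists y; split=> //; apply: connect1.
  by apply/and3P; split; [|exact: shell_near|].
have rz := edge_shell eyz ry zc.
have yl := shell_notin ry; have [yUW _] := ry.
have [zUW _ eqn] := S_UW yUW (edge_S yUW yl eyz).
split=> //; exists t; rewrite eqn; split=> //.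
apply: connect_trans ty (connect1 _).
by apply/and3P; split; [exact: shell_near | rewrite -eqn; exact: shell_near |].
Qed.

Lemma linked_D w u z : linked w u z -> D (M + L' + 8 * r) u z.
Proof.
case=> [->|[[zc _] _ [u' [u'c Du uz]]]]; first exact: (scale_refl DS).
have := scale_trans DS Du (scale_trans DS (foot_D u'c)
  (scale_trans DS (chi1_P uz) (scale_sym DS (foot_D zc)))).
by apply: (scale_le DS); clear; lia.
Qed.

Lemma reached_D w u y : reached w u y -> D (2 * M + L' + 8 * r) u y.
Proof.
case=> [[_ /linked_D]|[[yUW _] [z [_ /linked_D uz nz zy]]]].
  by apply: (scale_le DS); clear; lia.
apply: (scale_le DS _ (scale_trans DS uz (run_D yUW nz zy))).
by clear; lia.
Qed.

Lemma glued_bounded : bounded D r L Z glued.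
Proof.
have eC : connect_sym e by apply: sym_connect_sym; apply: mono_sym.
move=> x y xy; rewrite -/e in xy.
have eD u v : e u v -> D r u v by case/edge_Z.
(* If some foot is near [c], the whole component stays near [c]. The 12 * r below is 8 * r from
   [reached_D] plus 4 * r from a core vertex to its foot. *)
have [/existsP[w /and3P[wc xw wn]]|noN] :=
    boolP [exists w, [&& w \in core, connect e x w & near D Q c (foot w)]].
  apply: (scale_le DS L_ge2 _).
  have cn z : connect e x z -> near D (Q + (2 * M + L' + 12 * r)) c z.
    rewrite (same_connect eC xw) => /(reach wc)[u [uc _ uw uz _]].
    have un : near D Q c (foot u) by case: uw => [->|].
    apply: (near_trans DS _ (scale_sym DS (reached_D uz))
                            (near_trans DS (leqnn _) (foot_D uc) un)).
    by clear; lia.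
  apply: (scale_le DS _ (connect_near DS eD cn xy)).
  by move: sz_c; clear; nia.
(* With core vertices but no foot near [c], [reach] leaves only u = w, so both ends are close to
   [w]. *)
have [/existsP[w /andP[wc xw]]|noC] := boolP [exists w, (w \in core) && connect e x w].
  have wD z : connect e x z -> D (2 * M + L' + 8 * r) w z.
    rewrite (same_connect eC xw) => /(reach wc)[u [uc wu uw uz _]].
    case: uw uz => [->|un]; first exact: reached_D.
    case/existsP: noN; exists u.
    by rewrite uc un (connect_trans xw wu).
  apply: (scale_le DS L_ge1 _); rewrite mul2n -addnn.
  exact: (scale_trans DS (scale_sym DS (wD _ (connect0 _ _))) (wD _ xy)).
(* Without core vertices the component stays in one piece [S x] off its boundary layer, where
   [glued] is [chi0]. *)
have nc z : connect e x z -> z \notin core.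
  move=> xz; apply/negP=> zc; case/existsP: noC; exists z; by rewrite zc.
have [xZ|xZ] := boolP (x \in Z); last first.
  case/connectP: xy => [[|z p]] /=; first by move=> _ ->; apply: (scale_refl DS).
  by case/andP=> /edge_Z[]; rewrite (negPf xZ).
have [xUW xl] := notin_core xZ (nc _ (connect0 _ _)).
have [xS _ _ _ [_ _ [_ _ bd]]] := S_P xUW.
suff [_] : y \in S x /\ connect (mono D r (S x :\: lay0 (S x)) chi0) x y by apply: bd.
elim/connect_closed_ind: y / xy => [|y z xy [yS IH] eyz]; first by split.
have [yZ zZ gyz Dyz] := edge_Z eyz.
have [yUW yl] := notin_core yZ (nc _ xy).
have [zUW zl] := notin_core zZ (nc _ (connect_trans xy (connect1 eyz))).
have zS := edge_S yUW yl eyz.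
have [_ eqSy _] := S_UW xUW yS; have [_ eqSz _] := S_UW yUW zS.
rewrite eqSy in zS; split=> //; apply: connect_trans IH (connect1 _).
move: gyz; rewrite !glued_S // => gyz; rewrite eqSz in zl; rewrite eqSy in yl zl.
apply/and4P; split; [by apply/setDP|by apply/setDP|by rewrite gyz|by []].
Qed.
End Glue.

(** * Colouring the whole tree *)

Lemma staged_insulated (U : {set V}) c : U \subset X -> size c <= m.+1 ->
  {in lay0 U, forall x, near D (2 * r) c x} -> staged U c ->
  exists chi, insulated U chi.
Proof.
move=> UX sz_c lay0_c [W [S [nb [chi0 [WU S_P feet_dec]]]]].
pose F := feet U W c S nb.
have FU : F \subset U by apply: feet_U S_P.
have /colouring[chi1 chi1_P] : sepdec D N' F m q F.
  rewrite -{2}(setIidPl FU); apply: feet_dec; first exact: subset_trans FU UX.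
    by move=> x; rewrite inE => /andP[].
  by move=> x; apply: card_feet S_P _.
exists (glued U W c S nb chi0 chi1).
split; first by move=> x; apply: glued_lay1.
  by move=> x y; apply: glued_next.
exact: glued_bounded.
Qed.

(** The induction is over all [c] at once. A node with a centre near [c] drops that centre; any
    other node becomes a new stage, coloured by using the induction hypotheses with its own centres
    [bd]. *)
Lemma sepdec_staged (U : {set V}) c : sepdec D N X m.+1 q U -> U \subset X ->
  size c <= m.+1 -> staged U c.
Proof.
move=> decU; elim: decU c => {U} [U|A B _ IHA _ IHB dAB [bd sz_bd sepU]] c.
  by move=> ? _ _; apply: staged_small.
move=> UX; have := UX; rewrite subUset => /andP[AX BX] sz_c.
have [|far] := boolP (has (near D (6 * r) c) bd).
  move=> near_bd; apply: staged_node sepU _ => //; [exact: IHA|exact: IHB|].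
  rewrite size_filter -ltnS; apply: leq_trans sz_bd.
  rewrite -(count_predC (near D (6 * r) c) bd) -addn1 addnC leq_add2r.
  by rewrite -has_count.
have [chi ins] : exists chi, insulated (A :|: B) chi.
  apply: (staged_insulated UX sz_bd).
    move=> x /lay0P[xU [y yU Dxy]]; apply: (sepU r x y) => //.
    by rewrite r_gt0.
  (* Every centre in [bd] is near [bd], so none remains after filtering. *)
  apply: staged_node sepU _ => //; [exact: IHA|exact: IHB|].
  rewrite size_filter (eq_in_count (_ : {in bd, _ =1 pred0})) ?count_pred0 //.
  move=> b bbd /=; apply/negbTE; rewrite negbK; apply/hasP; exists b => //.
  exact: (scale_refl DS).
exact: staged_next sepU far ins.
Qed.

Lemma sepdec_bounded : sepdec D N X m.+1 q X -> exists chi, bounded D r L X chi.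
Proof.
(* The root has no boundary in [X], so it is a stage with no centres. *)
move=> decX; have stX := sepdec_staged decX (subxx _) (leq0n _ : size [::] <= _).
have lay0X : lay0 X = set0.
  by apply/setP=> x; rewrite in_set0; apply/negP=> /lay0P[_ [y]]; rewrite setDv inE.
have lay0_c : {in lay0 X, forall x, near D (2 * r) [::] x}.
  by move=> x; rewrite lay0X in_set0.
have [chi [_ _]] := @staged_insulated X [::] (subxx _) isT lay0_c stX.
by rewrite lay0X setD0; exists chi.
Qed.
End Step.

Lemma sepdec_colouring q m : m < q -> exists N C : nat, 0 < N /\
  forall (V : finType) (D : nat -> rel V) (r : nat) (X : {set V}),
    dist_scale D -> 0 < r -> sepdec D (N * r) X m q X ->
    exists chi, bounded D r (C * r) X chi.
Proof.
elim: m => [|m IH] lt_mq.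
  exists 1, (2 * q); split=> // V D r X DS r_gt0; rewrite mul1n => decX.
  by exists (fun=> true); apply: sepdec0_bounded.
have [N [C [N_gt0 colour]]] := IH (ltnW lt_mq).
(* Bounds at scale 1 of the quantities M, L', Q of the induction step. *)
pose M1 := m.+1 * 7 + 6; pose r1 := M1 + 8; pose C1 := 2 * M1 + C * r1 + 12.
pose Q1 := 6 + 2 * (N * r1).
exists (N * r1), (2 * C1 + (m.+1 * (2 * (Q1 + C1) + 1) + 2 * (Q1 + C1))).
split; first by rewrite muln_gt0 N_gt0 /r1 addnS.
move=> V D r X DS r_gt0 decX.
(* The recursive colouring is at scale r1 * r = M + 8 * r and needs separation up to N * (r1 * r),
   taken for both [N] and [N'] of the step. *)
apply: (@sepdec_bounded V D DS r (N * r1 * r) (N * r1 * r) m q _ (C * r1 * r)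
  (Q1 * r) (M1 * r)) decX => //.
- by rewrite leq_pmull // muln_gt0 N_gt0 /r1 addnS.
- exact: ltnW.
- by rewrite /M1; ring.
- by rewrite /Q1; ring.
- rewrite (_ : 2 * _ = (2 * (2 * M1 + C * r1 + 8)) * r); last by ring.
  by rewrite leq_mul2r /C1; apply/orP; right; clear; lia.
- rewrite [leqLHS](_ : _ = (m.+1 * (2 * (Q1 + C1) + 1) + 2 * (Q1 + C1)) * r).
    by rewrite leq_mul2r leq_addl orbT.
  by rewrite /C1; ring.
move=> Y decY.
have r1_gt0 : 0 < r1 * r by rewrite muln_gt0 r_gt0 /r1 addnS.
have [|chi bd] := colour V D (r1 * r) Y DS r1_gt0; first by rewrite mulnA.
by exists chi; rewrite -mulnDl -/r1 -mulnA.
Qed.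

(** * Graphs of bounded cliquewidth *)

Lemma dec_weaken (V : finType) q q' (P P' : {set V} -> Prop) (U : {set V}) :
  q <= q' -> (forall A, P A -> P' A) -> dec q P U -> dec q' P' U.
Proof.
move=> le_q sPP'; elim=> {U} [U le_U|A B _ dA _ dB dAB PAB].
  by apply: dec_small; apply: leq_trans le_q.
by apply: dec_node => //; apply: sPP'.
Qed.

Lemma dec_imset (V W : finType) (f : V -> W) q (P : {set V} -> Prop)
    (P' : {set W} -> Prop) (U : {set V}) :
  injective f -> (forall A : {set V}, P A -> P' (f @: A)) ->
  dec q P U -> dec q P' (f @: U).
Proof.
move=> f_inj sPP'; elim=> {U} [U le_U|A B _ dA _ dB dAB PAB].
  by apply: dec_small; rewrite card_imset.
rewrite imsetU; apply: dec_node => //; last by rewrite -imsetU; apply: sPP'.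
by rewrite -setI_eq0 -imsetI ?imset_eq0 ?setI_eq0 // => u v _ _; apply: f_inj.
Qed.

Definition gball (V : finType) (G : sgraph V) n : rel V := fun x y =>
  `[< exists p, [/\ path G x p, last x p = y & size p <= n] >].

Lemma gballP (V : finType) (G : sgraph V) n x y :
  reflect (exists p, [/\ path G x p, last x p = y & size p <= n]) (gball G n x y).
Proof. exact: asboolP. Qed.

Lemma gball_scale (V : finType) (G : sgraph V) : dist_scale (gball G).
Proof.
split=> [n x|n x y|m n x y z|m n x y le_mn].
- by apply/gballP; exists [::].
- case/gballP=> p [xp <- le_p]; apply/gballP; exists (rev (belast x p)).
  split; last by rewrite size_rev size_belast.
    by rewrite rev_path; apply: sub_path xp => u v; rewrite /= adj_sym.
  by case: p {xp le_p} => //= y' p; rewrite rev_cons last_rcons.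
- case/gballP=> p [xp <- le_p] /gballP[p' [yp <- le_p']]; apply/gballP.
  exists (p ++ p'); rewrite cat_path last_cat size_cat xp yp.
  by split=> //; apply: leq_add.
- case/gballP=> p [xp eq_y le_p]; apply/gballP; exists p.
  by split=> //; apply: leq_trans le_mn.
Qed.

Lemma gball1 (V : finType) (G : sgraph V) x y : G x y -> gball G 1 x y.
Proof. by move=> xy; apply/gballP; exists [:: y]; rewrite /= xy. Qed.

(* The colour classes of a cliquewidth-k pair at a stage of its construction:
   two vertices of one class keep a common colour in the sequel, hence the same
   neighbours among the vertices added later. *)
Definition twin_classes k (V : finType) (G : sgraph V) (c : V -> 'I_k)
    (A : {set V}) := exists cl : V -> 'I_k,
  {in A &, forall u v, cl u = cl v ->
    c u = c v /\ forall w, w \notin A -> G u w = G v w}.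

(** Only disjoint unions create nodes. Recolouring and joining treat vertices of equal colour alike,
    so the classes of earlier nodes survive. *)
Lemma cw_pair_dec k (V : finType) (G : sgraph V) (c : V -> 'I_k) :
  cw_pair G c -> dec 1 (twin_classes G c) [set: V].
Proof.
elim=> {V G c} [V G c le1|V G c A _ _ noE _ decA _ decA'
  |V G c c' i j _ _ _ _ decV c_def|V G G' c i j _ _ _ _ decV G_def].
- by apply: dec_small; rewrite cardsT.
- have sub (B : {set V}) : (forall u v, u \in B -> v \notin B -> ~~ G u v) ->
      dec 1 (twin_classes (induced G B) (fun u => c (val u))) [set: {x | x \in B}] ->
      dec 1 (twin_classes G c) B.
    move=> noEB decB.
    rewrite (_ : B = val @: [set: {x | x \in B}]); last first.
      apply/setP=> x; apply/idP/imsetP => [xB|[u _ ->]]; last exact: valP.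
      by exists (Sub x xB).
    apply: dec_imset decB; first exact: val_inj.
    move=> A0 [cl clP]; exists (fun x => oapp cl (c x) (insub x)).
    move=> _ _ /imsetP[u uA ->] /imsetP[v vA ->]; rewrite !valK /= => /clP[] // eq_c eq_G.
    split=> // w wA; case: (boolP (w \in B)) => wB.
      have wA0 : Sub w wB \notin A0 by apply: contra wA => ?; apply/imsetP; exists (Sub w wB).
      exact: (eq_G (Sub w wB) wA0).
    by rewrite !(negPf (noEB _ _ (valP _) wB)).
  rewrite -(setUCr A); apply: dec_node.
  - by apply: sub decA => u v uA vA; apply: noE; rewrite ?inE.
  - apply: sub decA' => u v uA vA; rewrite adj_sym; apply: noE => //.
    by move: vA; rewrite inE negbK.
  - by rewrite -setI_eq0 setICr.
  - by exists c => u v _ _ eq_c; split=> // w; rewrite setUCr inE.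
- apply: dec_weaken decV => // A [cl clP]; exists cl => u v uA vA /clP[] // eq_c eq_G.
  by split=> //; rewrite !c_def eq_c.
- apply: dec_weaken decV => // A [cl clP]; exists cl => u v uA vA /clP[] // eq_c eq_G.
  by split=> // w wA; rewrite !G_def eq_c eq_G.
Qed.

Lemma path_leaves (V : finType) (e : rel V) (A : {set V}) x p :
  path e x p -> x \in A -> last x p \notin A ->
  exists p' w, [/\ path e x p', last x p' \in A, w \notin A, e (last x p') w
                 & size p' < size p].
Proof.
elim: p x => [|y p IH] x /=; first by move=> _ ->.
case/andP=> xy yp xA lA; have [yA|yA] := boolP (y \in A).
  have [p' [w [yp' lA' wA lw lt_p]]] := IH y yp yA lA.
  by exists (y :: p'), w; rewrite /= xy.
by exists [::], y.
Qed.

(** [bd] has one vertex per nonempty class. If a path of length at most n leaves [A] by the edge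
    from [u] to [w], the representative of the class of [u] is also adjacent to [w], so it is within
    n + 1 <= 2 * n of the start. *)
Lemma twin_classes_sep k (V : finType) (G : sgraph V) (c : V -> 'I_k) N
    (A : {set V}) : twin_classes G c A ->
  exists2 bd, size bd <= k & sep (gball G) N [set: V] A bd.
Proof.
move=> [cl clP]; exists (pmap (fun i => [pick u in A | cl u == i]) (enum 'I_k)).
  by rewrite size_pmap (leq_trans (count_size _ _)) // size_enum_ord.
move=> n x y /andP[n_gt0 _] xA /setDP[_ yA] /gballP[p [xp eq_y le_p]].
rewrite -eq_y in yA; have [p' [w [xp' uA wA uw lt_p]]] := path_leaves xp xA yA.
set u := last x p' in uA uw; have eu : last x p' = u by [].
have [b bA [/eqP eq_cl bd_b]] : exists2 b, b \in A &
    cl b == cl u /\ b \in pmap (fun i => [pick u in A | cl u == i]) (enum 'I_k).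
  case E: [pick v in A | cl v == cl u] => [b|]; last first.
    by move: E; case: pickP => // /(_ u); rewrite uA eqxx.
  have : b \in A /\ cl b == cl u by move: E; case: pickP => // v /andP[? ?] [<-].
  case=> bA eq_cl; exists b => //; split=> //.
  by rewrite mem_pmap -E; apply: map_f; rewrite mem_enum.
have [_ /(_ w wA) eq_G] := clP _ _ bA uA eq_cl.
apply/hasP; exists b => //.
have Dxu : gball G (size p') x u by apply/gballP; exists p'.
have Dwb : gball G 1 w b by apply: (scale_sym (gball_scale G)); apply: gball1; rewrite eq_G.
apply: (scale_le (gball_scale G) _
  (scale_trans (gball_scale G) Dxu (scale_trans (gball_scale G) (gball1 uw) Dwb))).
by move: n_gt0 lt_p le_p; clear; lia.
Qed.

Lemma cw_colouring k : exists C : nat,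
  forall (V : finType) (G : sgraph V) n, cliquewidth G <= k -> 0 < n ->
  exists chi, bounded (gball G) n (C * n) [set: V] chi.
Proof.
(* Here q = k.+1, the least value allowed for k centres; leaves of the tree have at most one
   vertex. *)
have [N [C [N_gt0 colour]]] := sepdec_colouring (ltnSn k).
exists C => V G n; rewrite /cliquewidth; case: ex_minnP => k' /asboolP[c /cw_pair_dec decV] _.
move=> le_k n_gt0; apply: colour (gball_scale G) n_gt0 _.
apply: dec_weaken decV => // A /(twin_classes_sep (N * n))[bd le_bd sepA].
by exists bd => //; apply: leq_trans le_k.
Qed.

(** * Paths have cliquewidth at most 3 *)

Lemma line_extend (V : finType) (G : sgraph V) (f : V -> nat) n (c : V -> 'I_3)
    (a b : 'I_3) :
  (forall v, f v <= n.+1) -> injective f -> (forall i, i <= n.+1 -> exists v, f v = i) ->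
  (forall u v, G u v = (f u == (f v).+1) || (f v == (f u).+1)) ->
  a != b -> (forall v, (c v == a) = (f v == n)) -> (forall v, (c v == b) = (f v == n.+1)) ->
  (forall H : sgraph {x | x \in [set v | f v <= n]},
     (forall u v, H u v = G (val u) (val v)) -> cw_pair H (fun u => c (val u))) ->
  cw_pair G c.
Proof.
move=> f_le f_inj f_sur G_def nab ca cb pairH.
(* [g'] is the path without its last edge: a disjoint union of the shorter path and the new end,
   which the join of [a] and [b] connects. [pairH] allows any [H] because the summand is induced
   from [g'], not from [G]. *)
pose g' u v := [&& G u v, f u <= n & f v <= n].
have g'_sym : symmetric g' by move=> u v; rewrite /g' adj_sym [(f u <= n) && _]andbC.
have g'_irr : irreflexive g' by move=> u; rewrite /g' adj_irr.
have [x fx] := f_sur n.+1 (leqnn _); have [y fy] := f_sur n (leqnSn _).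
apply: (@CW_join _ _ _ (SGraph g'_sym g'_irr) c a b) => //.
- by move=> u v /and3P[].
- by exists x, y; rewrite /= /g' G_def fx fy eqxx ltnn.
- apply: (@CW_union _ _ _ _ [set v | f v <= n]).
  + by apply/set0Pn; exists y; rewrite inE fy.
  + by apply/set0Pn; exists x; rewrite !inE fx ltnn.
  + by move=> u v _; rewrite !inE /= /g' => /negPf->; rewrite !andbF.
  + apply: pairH => u v; rewrite /= /induced_adj /= /g'.
    by have := valP u; have := valP v; rewrite !inE => -> ->; rewrite !andbT.
  + apply: CW_small; rewrite card_sig; apply/card_le1P => u.
    have eq_f v : v \in ~: [set v | f v <= n] -> f v = n.+1.
      by rewrite !inE -ltnNge => lt_n; apply/eqP; rewrite eqn_leq f_le.
    move=> uA v; rewrite [RHS]inE; apply/idP/eqP => [vA|->//].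
    by apply: f_inj; rewrite !eq_f.
- move=> u v; rewrite /= /g' G_def !ca !cb.
  by have := f_le u; have := f_le v; clear; lia.
Qed.

(** Ends of the path alternate between two colours, so that a new end can be joined to the old end
    alone; [ord0] marks finished vertices. *)
Definition alt_colour m : 'I_3 := if odd m then inord 2 else inord 1.

Lemma line_cw_pair m (V : finType) (G : sgraph V) (f : V -> nat) (c : V -> 'I_3) :
  (forall v, f v <= m.+1) -> injective f -> (forall i, i <= m.+1 -> exists v, f v = i) ->
  (forall u v, G u v = (f u == (f v).+1) || (f v == (f u).+1)) ->
  (forall v, c v = if f v == m.+1 then alt_colour m else ord0) ->
  cw_pair G c.
Proof.
have alt0 n : (alt_colour n == ord0) = false.
  by rewrite /alt_colour; case: odd; apply/eqP=> /(congr1 val); rewrite /= inordK.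
have altS n : (alt_colour n == alt_colour n.+1) = false.
  by rewrite /alt_colour /=; case: odd; apply/eqP=> /(congr1 val); rewrite /= !inordK.
elim: m => [|m IH] in V G f c *; move=> f_le f_inj f_sur G_def c_def.
  apply: (@line_extend V G f 0 c ord0 (alt_colour 0)) => //.
  - by rewrite eq_sym alt0.
  - by move=> v; rewrite c_def; have := f_le v; case: (f v) => [|[|]] // _; rewrite alt0.
  - move=> v; rewrite c_def; case: ifP; rewrite ?eqxx // => _.
    by rewrite eq_sym alt0.
  - move=> H _; apply: CW_small; rewrite card_sig; apply/card_le1P => u.
    rewrite inE leqn0 => /eqP fu v; rewrite !inE leqn0 -fu.
    by rewrite (inj_eq f_inj).
(* The colouring just after the join; the old end is then recoloured to [ord0], which position 0
   already uses. *)
pose c' v := if f v == m.+2 then alt_colour m.+1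
             else if f v == m.+1 then alt_colour m else ord0.
have [x fx] := f_sur m.+1 (leqnSn _); have [y fy] := f_sur 0 isT.
apply: (@CW_recolour _ _ _ c c' (alt_colour m) ord0).
- by rewrite alt0.
- by exists x; rewrite /c' fx ltn_eqF // eqxx.
- by exists y; rewrite /c' fy.
- apply: (@line_extend V G f m.+1 c' (alt_colour m) (alt_colour m.+1)) => //.
  + by rewrite altS.
  + move=> v; rewrite /c'; case: (f v =P m.+2) => [->|_].
      by rewrite eq_sym altS eqn_leq ltnn.
    by case: (f v == m.+1); rewrite ?eqxx // eq_sym alt0.
  + move=> v; rewrite /c'; case: (f v == m.+2); first exact: eqxx.
    by case: (f v == m.+1); rewrite ?altS // eq_sym alt0.
  + move=> H H_def; apply: (IH _ _ (fun u => f (val u))).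
    * by move=> u; have := valP u; rewrite inE.
    * by move=> u v /f_inj/val_inj.
    * move=> i le_i; have [v fv] := f_sur i (leqW le_i).
      by have vA : v \in [set v | f v <= m.+1]; [rewrite inE fv | exists (Sub v vA)].
    * by move=> u v; rewrite H_def G_def.
    * move=> u; have := valP u; rewrite inE /c' => le_u.
      by rewrite ltn_eqF.
- move=> v; rewrite c_def /c'; case: (f v == m.+2); first by rewrite eq_sym altS.
  by case: (f v == m.+1); rewrite ?eqxx // eq_sym alt0.
Qed.

Section PathGraph.
Variable n : nat.

Definition line_adj : rel 'I_n := fun u v => (u == v.+1 :> nat) || (v == u.+1 :> nat).

Lemma line_sym : symmetric line_adj.
Proof. by move=> u v; rewrite /line_adj orbC. Qed.

Lemma line_irr : irreflexive line_adj.
Proof. by move=> u; rewrite /line_adj orbb ltn_eqF. Qed.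

Definition line := SGraph line_sym line_irr.

Lemma line_path (x : 'I_n) p : path line x p -> last x p <= x + size p.
Proof.
elim: p x => [|y p IH] x /=; first by rewrite addn0.
case/andP=> xy /IH le_y; apply: leq_trans le_y _.
by case/orP: xy => /eqP->; rewrite ?addSnnS // leq_add // leqW.
Qed.
End PathGraph.

Lemma line_cliquewidth m : cliquewidth (line m.+2) <= 3.
Proof.
rewrite /cliquewidth; case: ex_minnP => k _; apply; apply/asboolP.
exists (fun v : 'I_m.+2 => if v == m.+1 :> nat then alt_colour m else ord0).
apply: (@line_cw_pair m _ _ (@nat_of_ord _)) => //.
- by move=> v; rewrite -ltnS.
- exact: ord_inj.
- by move=> i le_i; exists (Ordinal (le_i : i < m.+2)).
Qed.

(** * Assouad-Nagata dimension *)

Section Distance.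
Import Order.TTheory GRing.Theory Num.Theory.
Local Open Scope ring_scope.
Local Open Scope ereal_scope.
Variables (R : realType) (V : finType) (G : sgraph V).

Lemma dist_le n u v : gball G n u v -> dist R G u v <= n%:R%:E.
Proof.
case/gballP=> p [up <- le_p]; case: (shortenP up) => p' up' uniq_p' sub_p'.
apply: le_trans (_ : (size p')%:R%:E <= _); last first.
  rewrite lee_fin ler_nat; apply: leq_trans le_p.
  by apply: uniq_leq_size sub_p'; case/andP: uniq_p'.
by apply: ereal_inf_lbound; exists p'.
Qed.

Lemma le_dist n u v : (forall m, gball G m u v -> (n <= m)%N) -> n%:R%:E <= dist R G u v.
Proof.
move=> le_n; apply: le_ereal_inf_tmp => _ [p [up _ eq_v] <-].
by rewrite lee_fin ler_nat; apply: le_n; apply/gballP; exists p.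
Qed.

Lemma dist_gt n (r : R) u v : (r < n.+1%:R)%R -> ~~ gball G n u v -> r%:E < dist R G u v.
Proof.
move=> lt_r uv; apply: lt_le_trans (_ : n.+1%:R%:E <= _); first by rewrite lte_fin.
apply: le_dist => m uvm; rewrite ltnNge; apply: contra uv => le_m.
exact: (scale_le (gball_scale G) le_m).
Qed.

Lemma weak_diam_le (S : {set V}) (x : R) : (0 <= x)%R ->
  {in S &, forall u v, dist R G u v <= x%:E} -> weak_diam R G S <= x%:E.
Proof.
move=> x_ge0 le_x; apply: bigmax_le => [|u uS]; first by rewrite lee_fin.
apply: bigmax_le => [|v vS]; first by rewrite lee_fin.
exact: le_x.
Qed.

Lemma dist_le_weak_diam (S : {set V}) u v : u \in S -> v \in S ->
  dist R G u v <= weak_diam R G S.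
Proof.
move=> uS vS; apply: le_trans (le_bigmax_cond _ _ uS).
exact: (le_bigmax_cond _ (fun v => dist R G u v) vS).
Qed.
End Distance.

Section Dimension.
Import Order.TTheory GRing.Theory Num.Theory.
Local Open Scope ring_scope.
Variable R : realType.

Lemma cw_control k : exists2 d : R -> R, dilation d & control_function 1 d (cw_at_most k).
Proof.
have [C colour] := cw_colouring k.
exists (fun r => C%:R * r); first by exists C%:R.
move=> V G le_k r r_ge0.
(* Below scale 1 singletons do: distinct vertices are at distance at least 1, and the diameters are
   0. *)
have [r_lt1|r_ge1] := ltP r 1.
  exists (fun i => if i == ord0 then [set [set x] | x in V] else set0); split.
  - apply/setP=> x; rewrite inE; apply/bigcupP; exists ord0 => //=.
    by apply/bigcupP; exists [set x]; rewrite ?inE // imset_f.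
  - move=> i S T; case: ifP => [_|]; last by rewrite inE.
    case/imsetP=> x _ -> /imsetP[y _ ->] nxy u v; rewrite !inE => /eqP-> /eqP->.
    apply: (@dist_gt _ _ _ 0) => //; apply: contra nxy => /gballP[[|z p] [//= _ -> _]].
    exact: eqxx.
  - move=> i S; case: ifP => [_|]; last by rewrite inE.
    case/imsetP=> x _ ->; apply: weak_diam_le => [|u v]; first by rewrite mulr_ge0.
    rewrite !inE => /eqP-> /eqP->; apply: le_trans (_ : (0%:R%:E <= _)%E).
      by apply: dist_le; apply: (scale_refl (gball_scale G)).
    by rewrite lee_fin mulr_ge0.
(* Distances are integers or infinite, so a distance above n is at least n.+1 > r. *)
pose n := Num.truncn r.
have /andP[le_nr lt_rn] := truncn_itv r_ge0; rewrite -/n in le_nr lt_rn.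
have n_gt0 : (0 < n)%N.
  by rewrite -ltnS -(ltr_nat R); apply: le_lt_trans r_ge1 lt_rn.
have [chi bd] := colour V G n le_k n_gt0.
set e := mono (gball G) n [set: V] chi in bd.
have eC : connect_sym e by apply/sym_connect_sym/(mono_sym (gball_scale G)).
exists (fun i => [set [set y | connect e x y] | x in [set x | chi x == (i == ord0)]]).
split.
- apply/setP=> x; rewrite inE; apply/bigcupP.
  exists (if chi x then ord0 else ord_max) => //=; apply/bigcupP.
  exists [set y | connect e x y]; last by rewrite inE connect0.
  by apply: imset_f; rewrite inE; case: (chi x).
- move=> i S T /imsetP[x + ->] /imsetP[y + ->]; rewrite !inE => /eqP xi /eqP yi.
  have chiE z t : connect e z t -> chi t = chi z.
    by move=> zt; elim/connect_closed_ind: t / zt => // t t' _ <- /and4P[_ _ /eqP].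
  move=> nST u v; rewrite !inE => xu yv; apply: (dist_gt lt_rn).
  apply: contra nST => Duv; apply/eqP/setP=> z; rewrite !inE.
  have uv : e u v by apply/and4P; rewrite !inE (chiE _ _ xu) (chiE _ _ yv) xi yi.
  by rewrite (same_connect eC xu) (same_connect1 eC uv) (same_connect eC yv).
- move=> i S /imsetP[x _ ->]; apply: weak_diam_le => [|u v].
    by rewrite mulr_ge0.
  rewrite !inE => xu xv; apply: le_trans (_ : ((C * n)%:R%:E <= _)%E).
    by apply/dist_le/bd; rewrite -(same_connect eC xu).
  by rewrite lee_fin natrM ler_wpM2l.
Qed.

Lemma cw_not_control0 k (d : R -> R) : (3 <= k)%N -> ~ control_function 0 d (cw_at_most k).
Proof.
(* The ends of the path with m.+2 vertices are at distance m.+1, which exceeds [d 1]. *)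
move=> k_ge3 ctrl; pose m := Num.truncn (d 1).
have cw_le : cw_at_most k (line m.+2) := leq_trans (line_cliquewidth m) k_ge3.
have [C [covC disjC diamC]] := ctrl _ _ cw_le 1 ler01.
have inC v : exists2 S, S \in C ord0 & v \in S.
  have : v \in [set: 'I_m.+2] by [].
  rewrite -covC => /bigcupP[i _]; rewrite (ord1 i) => /bigcupP[S SC vS].
  by exists S.
have [S SC S0] := inC ord0.
(* Members containing adjacent vertices are not 1-disjoint, so they coincide. *)
have inS i (lt_i : (i < m.+2)%N) : Ordinal lt_i \in S.
  elim: i lt_i => [|i IH] lt_i; first by rewrite (_ : Ordinal _ = ord0) //; apply: val_inj.
  have iS := IH (ltnW lt_i); have [T TC iT] := inC (Ordinal lt_i).
  case: (eqVneq S T) => [-> //|nST].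
  have := disjC _ _ _ SC TC nST _ _ iS iT; rewrite ltNge => /negP[].
  by apply: (@dist_le _ _ _ 1); apply: gball1; rewrite /= /line_adj /= eqxx orbT.
have := le_trans (dist_le_weak_diam R (line m.+2) S0 (inS m.+1 (ltnSn _))) (diamC _ _ SC).
apply/negP; rewrite -ltNge; apply: lt_le_trans (_ : (m.+1%:R%:E <= _)%E).
  by rewrite lte_fin truncnS_gt.
apply: le_dist => n /gballP[p [xp lp le_p]]; apply: leq_trans le_p.
by have := line_path xp; rewrite lp.
Qed.
End Dimension.

Theorem theorem5 (R : realType) (k : nat) (hk : (3 <= k)%N) :
  AN_dim R (cw_at_most k) = 1%E.
Proof.
apply/eqP; rewrite Order.POrderTheory.eq_le; apply/andP; split.
  by apply: ereal_inf_lbound; exists 1; [apply: cw_control|].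
apply: le_ereal_inf_tmp => _ [[|n] [d _ ctrl] <-].
  by case: (cw_not_control0 hk ctrl).
by rewrite constructive_ereal.lee_fin Num.Theory.ler1n.
Qed.
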